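(* There is a $2$-DFAO with $9$ states that, for every $n\geq 1$, on input $(n)_2$ returns the greatest circular critical exponent over all length-$n$ factors of the Thue-Morse word $\mathbf{t}$, that is, $\max\{\mathrm{cce}(x) : x \text{ is a factor of } \mathbf{t},\ |x|=n\}$.
   Context: The Thue-Morse word $\mathbf{t} = t_0 t_1 t_2 \cdots = 01101001\cdots$ is the infinite fixed point, starting with $0$, of the morphism $\mu$ with $\mu(0)=01$, $\mu(1)=10$. A nonempty finite word $w$ (indexed from $0$) has period $p$, where $1 \le p \le |w|$, if $w[i]=w[i+p]$ for all $i$ with $0 \le i < |w|-p$. The smallest period of $w$ is denoted $p(w)$, and the exponent of $w$ is $\exp(w) = |w|/p(w)$. A factor of a word is a contiguous block inside it. The conjugates of a finite word $w$ are its cyclic shifts, i.e. the words $yx$ with $w = xy$ ($x,y$ possibly empty). The circular critical exponent $\mathrm{cce}(w)$ of a nonempty finite word $w$ is the supremum (maximum) of $\exp(x)$ over all nonempty factors $x$ of all conjugates of $w$. A $k$-DFAO (deterministic finite automaton with output) is $M=(Q,\Sigma_k,\delta,q_0,\Delta,\tau)$, where $Q$ is a finite nonempty set of states, $\Sigma_k=\{0,1,\ldots,k-1\}$ is the input alphabet, $\delta:Q\times\Sigma_k\to Q$ is the transition function (extended to $Q\times\Sigma_k^*$ in the usual way), $q_0\in Q$ is the initial state, $\Delta$ is the (finite) output alphabet (here a finite set of rational numbers), and $\tau:Q\to\Delta$ is the output map. On input $x \in \Sigma_k^*$ it returns $\tau(\delta(q_0,x))$. $(n)_2$ denotes the base-$2$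 representation of $n$, read starting with the most significant digit. *)

(* Defs.v *)
From mathcomp Require Import all_boot all_order all_algebra.

Set Implicit Arguments.
Unset Strict Implicit.
Unset Printing Implicit Defensive.

Import Order.TTheory GRing.Theory Num.Theory.

Local Open Scope ring_scope.

Definition greatest (P : rat -> Prop) (m : rat) : Prop :=
  P m /\ forall e, P e -> e <= m.

(* The letters 0 and 1 are [false] and [true]. *)
Definition mu (b : bool) : seq bool := [:: b; ~~ b].

Definition mu_word (w : seq bool) : seq bool := flatten [seq mu b | b <- w].

(* [mu^n(0)] has length [2 ^ n > n], and these words are prefixes of one
   another; [thue_morse_fixed] and [thue_morse_unique] below show that the
   limit is the only infinite fixed point of [mu] starting with 0. *)
Definition thue_morse (n : nat) : bool := nth false (iter n mu_word [:: false]) n.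

Definition factor_of (t : nat -> bool) (x : seq bool) : Prop :=
  exists i, x = mkseq (fun j => t (i + j)%N) (size x).

Section Words.

Variable T : eqType.
Implicit Types (w x : seq T) (p : nat).

Definition has_period w p : bool :=
  (1 <= p <= size w)%N &&
  all (fun i => onth w i == onth w (i + p)) (iota 0 (size w - p)).

(* A nonempty [w] has period [size w], so the default value of the minimum is
   itself one of the competing periods. *)
Definition min_period w : nat :=
  \big[minn/size w]_(1 <= p < (size w).+1 | has_period w p) p.

Definition word_exp w : rat := (size w)%:R / (min_period w)%:R.

Definition conjugates w : seq (seq T) :=
  [seq rot i w | i <- iota 0 (size w).+1].

Definition factors w : seq (seq T) :=
  [seq take l (drop i w) | i <- iota 0 (size w), l <- iota 1 (size w - i)].

(* Exponents are positive, so the default value 0 is never attained when [w] is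
   nonempty; see [cceP]. *)
Definition cce w : rat :=
  \big[Num.max/0]_(v <- conjugates w) \big[Num.max/0]_(x <- factors v) word_exp x.

End Words.

Record dfao (k : nat) (A : eqType) := Dfao {
  dfao_state :> finType;
  dfao_step : dfao_state -> 'I_k -> dfao_state;
  dfao_init : dfao_state;
  dfao_alphabet : seq A;
  dfao_out : dfao_state -> A;
  dfao_outP : forall q, dfao_out q \in dfao_alphabet
}.

Definition dfao_run (k : nat) (A : eqType) (M : dfao k A) (x : seq 'I_k) : A :=
  dfao_out (foldl (@dfao_step k A M) (dfao_init M) x).

(* Most significant digit first, no leading zeros; only meant for [0 < n]. *)
Definition base2 (n : nat) : seq 'I_2 :=
  rev [seq inord (n %/ 2 ^ i %% 2) | i <- iota 0 (trunc_log 2 n).+1].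

Lemma mu_word_cat u v : mu_word (u ++ v) = mu_word u ++ mu_word v.
Proof. by rewrite /mu_word map_cat flatten_cat. Qed.

Lemma size_mu_word w : size (mu_word w) = (size w).*2.
Proof. by elim: w => //= b w; rewrite /mu_word /= => ->. Qed.

Lemma nth_mu_word w n : (n < (size w).*2)%N ->
  nth false (mu_word w) n = odd n (+) nth false w n./2.
Proof.
elim: w n => [|b w IH] [|[|n]] //= lt_n.
by rewrite negbK; apply: IH; rewrite -2!ltnS.
Qed.

Lemma size_iter_mu n : size (iter n mu_word [:: false]) = (2 ^ n)%N.
Proof. by elim: n => //= n IH; rewrite size_mu_word IH expnS mul2n. Qed.

Lemma nth_iter_mu n m i : (i < 2 ^ n)%N -> (i < 2 ^ m)%N ->
  nth false (iter n mu_word [:: false]) i = nth false (iter m mu_word [:: false]) i.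
Proof.
have half_lt q k : (k < 2 ^ q.+1)%N -> (k./2 < 2 ^ q)%N.
  by move=> ltk; rewrite ltn_half_double -mul2n -expnS.
have nth0 q : nth false (iter q mu_word [:: false]) 0 = false.
  by elim: q => //= q IH; rewrite nth_mu_word ?size_iter_mu ?double_gt0 ?expn_gt0.
elim: n m i => [|n IH] [|m] i.
- by [].
- by rewrite expn0 ltnS leqn0 => /eqP -> _; rewrite !nth0.
- by rewrite expn0 ltnS leqn0 => _ /eqP ->; rewrite !nth0.
move=> ltn ltm /=; rewrite !nth_mu_word ?size_iter_mu -?mul2n -?expnS //.
by rewrite (IH m) ?half_lt.
Qed.

Lemma thue_morse_rec n : thue_morse n = odd n (+) thue_morse n./2.
Proof.
have lt_n : (n < 2 ^ n)%N by rewrite ltn_expl.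
have le_half : (n./2 <= n)%N by rewrite -{2}(odd_double_half n) -addnn addnA leq_addl.
have lt_half : (n./2 < 2 ^ n./2)%N by rewrite ltn_expl.
have lt_nS : (n < 2 ^ n.+1)%N by rewrite expnS mul2n -addnn (leq_trans lt_n) ?leq_addr.
rewrite /thue_morse (nth_iter_mu lt_n lt_nS) iterS nth_mu_word; last first.
  by rewrite size_iter_mu -mul2n -expnS.
by rewrite (nth_iter_mu (leq_ltn_trans le_half lt_n) lt_half).
Qed.

Definition fixed_by_mu (t : nat -> bool) : Prop :=
  forall n, mu_word (mkseq t n) = mkseq t n.*2.

Lemma thue_morse_fixed : thue_morse 0 = false /\ fixed_by_mu thue_morse.
Proof.
split; first by [].
move=> n; apply: (@eq_from_nth _ false) => [|i].
  by rewrite size_mu_word !size_mkseq.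
rewrite size_mu_word size_mkseq => lt_i.
rewrite nth_mu_word ?size_mkseq // !nth_mkseq // ?ltn_half_double //.
by rewrite [RHS]thue_morse_rec.
Qed.

Lemma thue_morse_unique t : t 0 = false -> fixed_by_mu t -> t =1 thue_morse.
Proof.
move=> t0 tmu n; elim/ltn_ind: n => -[//|n] IH.
rewrite thue_morse_rec -IH; last first.
  by rewrite ltn_half_double -addnn addnS ltnS leq_addr.
have lt_n : (n.+1 < (n.+2).*2)%N by rewrite -addnn addnS ltnS leqW ?leq_addr.
have /(congr1 (nth false ^~ n.+1)) := tmu n.+2.
rewrite nth_mu_word ?size_mkseq // nth_mkseq ?ltn_half_double //.
by rewrite nth_mkseq.
Qed.

Lemma min_periodP (T : eqType) (w : seq T) : w != [::] ->
  has_period w (min_period w) /\ forall p, has_period w p -> (min_period w <= p)%N.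
Proof.
move=> w_neq0.
have per_w : has_period w (size w).
  by rewrite /has_period leqnn subnn andbT lt0n size_eq0 w_neq0.
split; first by rewrite /min_period; elim/big_ind: _ => // p q pp qq; rewrite /minn; case: ifP.
move=> p per_p.
have : p \in index_iota 1 (size w).+1.
  by rewrite mem_index_iota ltnS; case/andP: per_p.
rewrite /min_period; elim: (index_iota _ _) => //= a s IH; rewrite inE big_cons.
case/predU1P => [<-|/IH le_p]; first by rewrite per_p geq_minl.
by case: ifP => // _; apply: leq_trans le_p; apply: geq_minr.
Qed.

Lemma conjugatesP (T : eqType) (w v : seq T) :
  v \in conjugates w <-> exists x y, w = x ++ y /\ v = y ++ x.
Proof.
split=> [/mapP[i _ ->]|[x [y [-> ->]]]].
  by exists (take i w), (drop i w); rewrite cat_take_drop.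
apply/mapP; exists (size x); last by rewrite rot_size_cat.
by rewrite mem_iota size_cat add0n ltnS leq_addr.
Qed.

Lemma factorsP (T : eqType) (w x : seq T) :
  x \in factors w <-> x != [::] /\ infix x w.
Proof.
split=> [/allpairsPdep[i [l [+ + ->]]]|[x_neq0 /infixP[u [v def_w]]]].
  rewrite !mem_iota /= add0n => lt_i /andP[l_gt0 lt_l].
  split.
    rewrite -size_eq0 size_takel; first by rewrite -lt0n.
    by rewrite size_drop -ltnS -add1n.
  apply/infixP; exists (take i w), (drop l (drop i w)).
  by rewrite !cat_take_drop.
have x_gt0 : (0 < size x)%N by rewrite lt0n size_eq0.
apply/allpairsPdep; exists (size u), (size x); split.
- by rewrite mem_iota def_w !size_cat add0n -[X in (X < _)%N]addn0 ltn_add2l addn_gt0 x_gt0.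
- by rewrite mem_iota x_gt0 def_w !size_cat addKn add1n ltnS leq_addr.
- by rewrite def_w drop_size_cat // take_size_cat.
Qed.

Lemma bigmax_ge0 (I : Type) (r : seq I) (F : I -> rat) :
  0 <= \big[Num.max/0]_(i <- r) F i.
Proof. by elim: r => [|i r IH]; rewrite ?big_nil // big_cons le_max IH orbT. Qed.

Lemma bigmax_greatest (I : eqType) (r : seq I) (F : I -> rat) : r != [::] ->
  (forall i, i \in r -> 0 <= F i) ->
  greatest (fun e => exists2 i, i \in r & e = F i) (\big[Num.max/0]_(i <- r) F i).
Proof.
elim: r => // a r IH _ F_ge0; rewrite big_cons; split; last first.
  move=> e [i + ->]; rewrite inE le_max => /predU1P[->|ri]; first by rewrite lexx.
  have [||_ ->] := IH; rewrite ?orbT //; first by case: (r) ri.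
    by move=> j rj; apply: F_ge0; rewrite inE rj orbT.
  by exists i.
have [->|r_neq0] := eqVneq r [::].
  by rewrite big_nil; exists a; rewrite ?mem_head // max_l // F_ge0 ?mem_head.
have [|[i ri ->] _] := IH r_neq0.
  by move=> j rj; apply: F_ge0; rewrite inE rj orbT.
rewrite maxEle; case: ifP => _; [exists i | exists a] => //.
  by rewrite inE ri orbT.
by rewrite mem_head.
Qed.

Lemma cceP (T : eqType) (w : seq T) : w != [::] ->
  greatest (fun e => exists v x, (exists y z, w = y ++ z /\ v = z ++ y) /\
              [/\ x != [::], infix x v & e = word_exp x]) (cce w).
Proof.
move=> w_neq0; rewrite /cce.
have exp_ge0 (x : seq T) : 0 <= word_exp x by rewrite divr_ge0 ?ler0n.
have conj_neq0 : conjugates w != [::] by rewrite -size_eq0 size_map size_iota.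
have [||[v vw ->] le_cce] := @bigmax_greatest _ (conjugates w)
  (fun v => \big[Num.max/0]_(x <- factors v) word_exp x) => //.
  by move=> v _; apply: bigmax_ge0.
have fac_neq0 u : u \in conjugates w -> factors u != [::].
  case/mapP=> i _ ->; have : rot i w \in factors (rot i w).
    by apply/factorsP; rewrite infix_refl -size_eq0 size_rot size_eq0.
  by case: (factors _).
split.
  have [||[x xv ->] _] := @bigmax_greatest _ (factors v) (@word_exp T) => //.
    exact: fac_neq0.
  have /factorsP[x_neq0 x_in_v] := xv.
  exists v, x; split; last by split.
  by apply/conjugatesP.
move=> e [u [x [/conjugatesP uw [x0 xu ->]]]]; apply: le_trans (le_cce _ _); last by exists u.
have [||_ ->] := @bigmax_greatest _ (factors u) (@word_exp T) => //.
  exact: fac_neq0.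
by exists x => //; apply/factorsP.
Qed.

Lemma base2P n : (0 < n)%N ->
  head ord0 (base2 n) = 1%N :> nat /\
  foldl (fun m (d : 'I_2) => (2 * m + d)%N) 0%N (base2 n) = n.
Proof.
move=> n_gt0; have /andP[le_n lt_n] := @trunc_log_bounds 2 n isT n_gt0.
split.
  rewrite /base2 -[(trunc_log 2 n).+1]addn1 iotaD map_cat rev_cat /= inordK ?ltn_pmod //.
  have -> : (n %/ 2 ^ trunc_log 2 n = 1)%N; last by [].
  apply/eqP; rewrite eqn_leq leq_divRL ?expn_gt0 // mul1n le_n andbT.
  by rewrite -ltnS ltn_divLR ?expn_gt0 // -expnS.
rewrite /base2 foldl_rev -[RHS](modn_small lt_n).
move: (trunc_log 2 n).+1 => {n_gt0 le_n lt_n} k.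
elim: k n => [|k IH] n /=; first by rewrite modn1.
rewrite (iotaDl 1 0) -map_comp.
under eq_map => i do rewrite /= add1n expnS divnMA.
rewrite IH expn0 divn1 inordK ?ltn_pmod //.
set q := (n %/ 2)%N; set r := (q %% 2 ^ k)%N.
have lt_r : (r < 2 ^ k)%N by rewrite ltn_pmod ?expn_gt0.
have def_n : n = (q %/ 2 ^ k * 2 ^ k.+1 + (2 * r + n %% 2))%N.
  by rewrite expnSr mulnA addnA [(2 * r)%N]mulnC -mulnDl -divn_eq -divn_eq.
have lt_s : (2 * r + n %% 2 < 2 ^ k.+1)%N.
  apply: (@leq_trans (2 * r.+1)%N); last by rewrite expnS leq_mul2l.
  by rewrite mulnS addnC ltn_add2r ltn_pmod.
by rewrite [in RHS]def_n modnMDl (modn_small lt_s).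
Qed.

(* Main.v *)
Require Import Defs.
From mathcomp Require Import all_boot all_order all_algebra.
From mathcomp Require Import zify.

Set Implicit Arguments.
Unset Strict Implicit.
Unset Printing Implicit Defensive.

Import Order.TTheory GRing.Theory Num.Theory.

(* The Thue-Morse word is overlap-free, so a factor of a conjugate with period
   [p] has at most [2 * p] letters on each side of the seam where the conjugate
   wraps around, whence the bound 4.  The letter pairs 00 and 11 occur in the
   Thue-Morse word at odd positions only; when the length [n] is odd, the parities
   on the two sides of the seam disagree, which lowers the bound to 3, except
   for the word 0101010 or its complement across the seam, of exponent 7/2, which
   forces [n = 3 %[mod 4]] and [n != 15].  For most [n] the bounds are attained
   by repetitions across the seam, found by desubstituting [mu] in
   the required pattern of letters at distance about [n]. *)

(** * Recurrences of the Thue-Morse word modulo 2 and 4 *)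

Local Notation t := thue_morse.

Lemma thue_morse_double k : t k.*2 = t k.
Proof. by rewrite thue_morse_rec odd_double doubleK. Qed.

Lemma thue_morse_doubleS k : t k.*2.+1 = ~~ t k.
Proof. by rewrite thue_morse_rec /= odd_double uphalf_double. Qed.

Lemma thue_morse_even k : ~~ odd k -> t k.+1 = ~~ t k.
Proof.
move=> ek; have -> : k = k./2.*2 by lia.
by rewrite thue_morse_doubleS thue_morse_double.
Qed.

Lemma thue_morse_mul4 q : t (4 * q) = t q.
Proof. by rewrite (_ : 4 * q = q.*2.*2) ?thue_morse_double //; lia. Qed.

Lemma thue_morse_mul4D1 q : t (4 * q + 1) = ~~ t q.
Proof.
rewrite (_ : 4 * q + 1 = q.*2.*2.+1); last by lia.
by rewrite thue_morse_doubleS thue_morse_double.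
Qed.

Lemma thue_morse_mul4D2 q : t (4 * q + 2) = ~~ t q.
Proof.
rewrite (_ : 4 * q + 2 = q.*2.+1.*2); last by lia.
by rewrite thue_morse_double thue_morse_doubleS.
Qed.

Lemma thue_morse_mul4D3 q : t (4 * q + 3) = t q.
Proof.
rewrite (_ : 4 * q + 3 = q.*2.+1.*2.+1); last by lia.
by rewrite !thue_morse_doubleS negbK.
Qed.

(** * Repeated letters, overlap-freeness and alternating factors *)

Lemma odd_equal_pair k : t k = t k.+1 -> odd k.
Proof. by apply: contra_eqT => ek; rewrite thue_morse_even //; case: (t k). Qed.

(** Otherwise [f] alternates from [m] to [m + p], and an odd number of alternations changes the
    letter. *)
Lemma odd_return (f : nat -> bool) m p : odd p -> f m = f (m + p) ->
  exists2 k, m <= k < m + p & f k = f k.+1.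
Proof.
move=> op fmp.
have [/hasP[k]|/hasPn alt] := boolP (has (fun k => f k == f k.+1) (iota m p)).
  by rewrite mem_iota => ? /eqP; exists k.
suff altm j : j <= p -> f (m + j) = odd j (+) f m.
  by move: fmp; rewrite altm // op; case: (f m).
elim: j => [|j IH] lej; first by rewrite addn0.
have /alt : m + j \in iota m p by rewrite mem_iota; lia.
rewrite addnS /= IH ?(ltnW lej) //.
by case: (f _) (odd j) (f m) => [] [] [].
Qed.

(** Descent on the period. If [p] is odd, some repeated letter recurs at distance [p], yet both
    occurrences sit at odd positions; if [p] is even, undoing [mu] gives an overlap of period
    [p./2]. *)
Lemma thue_morse_overlap_free p i : 0 < p ->
  ~ (forall j, i <= j <= i + p -> t j = t (j + p)).
Proof.
elim/ltn_ind: p i => p IH i p_gt0 per.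
have [op|ep] := boolP (odd p).
  have [|k lek eqk] := @odd_return t i p op; first by apply: per; lia.
  have ok := odd_equal_pair eqk.
  have : odd (k + p) by apply: odd_equal_pair; rewrite -per -?addSn -?per //; lia.
  lia.
apply: (IH p./2 _ i./2); [lia | lia | move=> j lej].
have [oi|ei] := boolP (odd i).
  have /per : i <= j.*2.+1 <= i + p by lia.
  have -> : j.*2.+1 + p = (j + p./2).*2.+1 by lia.
  by rewrite !thue_morse_doubleS => /negb_inj.
have /per : i <= j.*2 <= i + p by lia.
have -> : j.*2 + p = (j + p./2).*2 by lia.
by rewrite !thue_morse_double.
Qed.

Lemma thue_morse_period_le i l p : 0 < p ->
  (forall k, k + p < l -> t (i + k) = t (i + k + p)) -> l <= p.*2.
Proof.
move=> p_gt0 per; rewrite leqNgt; apply/negP => ltl.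
apply: (@thue_morse_overlap_free p i p_gt0) => j lej.
by have := per (j - i); rewrite subnKC; [apply; lia | lia].
Qed.

Lemma thue_morse_no_cube i : ~ (t i = t i.+1 /\ t i.+1 = t i.+2).
Proof. by case=> e1 e2; have := odd_equal_pair e1; have := odd_equal_pair e2; lia. Qed.

Lemma thue_morse_no_alt5 i : ~ [/\ t i = t (i + 2), t (i + 1) = t (i + 3)
  & t (i + 2) = t (i + 4)].
Proof.
case=> e0 e1 e2; suff : 5 <= 2.*2 by [].
apply: (@thue_morse_period_le i 5 2) => // -[|[|[|k]]]; last by lia.
- by rewrite addn0.
- by rewrite -addnA.
- by rewrite -addnA.
Qed.

(** At an odd [i], the preceding letter is the other half of a block [mu b], so it extends the four
    alternating letters to a forbidden five. *)
Lemma thue_morse_alt4_even i :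
  t i <> t (i + 1) -> t i = t (i + 2) -> t (i + 1) = t (i + 3) -> ~~ odd i.
Proof.
case: i => // i n0 e0 e1; apply/negP => ei.
apply: (@thue_morse_no_alt5 i); rewrite !addSn !addnS !addn0 in n0 e0 e1 *.
split=> //; move: n0; rewrite (@thue_morse_even i) //.
by case: (t i) (t i.+2) => [] [].
Qed.

Lemma thue_morse_aba_mod4 i : ~~ odd i -> t i = t (i + 2) -> i %% 4 = 2.
Proof.
move=> ei; have -> : i = i./2.*2 by lia.
have -> : i./2.*2 + 2 = i./2.+1.*2 by lia.
by rewrite !thue_morse_double => /odd_equal_pair; lia.
Qed.

(** Whatever the middle letter, the pattern [ab?ba] would contain [ababa] or [bbb]. This is what
    excludes [n = 15] from exponent 7/2. *)
Lemma thue_morse_no_ab_ba i :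
  t (i + 1) <> t i -> t (i + 3) <> t i -> t (i + 4) <> t i.
Proof.
move=> n1 n3 e4; have := @thue_morse_no_cube i.+1.
have := @thue_morse_no_alt5 i; rewrite !addnS addn0 in n1 n3 e4 *.
case: (t i) (t i.+1) (t i.+2) (t i.+3) (t i.+4) n1 n3 e4
  => [] [] [] [] [] n1 n3 e4 no5 no3 //;
  by [case: n1 | case: n3 | case: no5 | case: no3].
Qed.

(** * Prescribed letters at a given distance *)

(** Descent on the distance: from an even position, an odd [d] lands on the second letter of a
    block, which complements the relation at distance [d./2]. *)
Lemma thue_morse_return d b : (0 < d) || ~~ b -> exists i, t i (+) t (i + d) = b.
Proof.
elim/ltn_ind: d b => d IH b; have [->|d_gt0 _] := posnP d.
  by case: b => // _; exists 0.
have [od|ed] := boolP (odd d); last first.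
  have [||i <-] := IH d./2 _ b; [lia | lia | exists i.*2].
  have -> : i.*2 + d = (i + d./2).*2 by lia.
  by rewrite !thue_morse_double.
have [d1|d_gt1] := eqVneq d 1.
  by rewrite d1; exists (~~ b); case: b.
have [||i def_b] := IH d./2 _ (~~ b); [lia | lia | exists i.*2].
have -> : i.*2 + d = (i + d./2).*2.+1 by lia.
by rewrite thue_morse_doubleS thue_morse_double addbN def_b negbK.
Qed.

(** The start is chosen so that the far end opens a block [mu b], whose two letters differ. *)
Lemma thue_morse_return_ab d b : (0 < d) || ~~ b ->
  exists2 i, t i (+) t (i + d) = b & t (i + d).+1 = ~~ t (i + d).
Proof.
move=> db; have [od|ed] := boolP (odd d); last first.
  have [|i <-] := @thue_morse_return d./2 b; first by lia.
  exists i.*2; last by apply: thue_morse_even; lia.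
  have -> : i.*2 + d = (i + d./2).*2 by lia.
  by rewrite !thue_morse_double.
have [|i def_b] := @thue_morse_return d./2.+1 (~~ b); first by lia.
exists i.*2.+1; last by apply: thue_morse_even; lia.
have -> : i.*2.+1 + d = (i + d./2.+1).*2 by lia.
by rewrite thue_morse_doubleS thue_morse_double addNb def_b negbK.
Qed.

(** The far end is made to close a block; the next block then starts with the same letter exactly
    when the two letters being substituted differ. Distance 1 with equal letters would be a cube. *)
Lemma thue_morse_return_aa d b : (if b then 0 < d else d != 1) ->
  exists2 i, t i (+) t (i + d) = b & t (i + d).+1 = t (i + d).
Proof.
move=> db; have [od|ed] := boolP (odd d).
  have [|i def_b eqi] := @thue_morse_return_ab d./2 (~~ b).
    by case: b db => /=; lia.
  exists i.*2; have -> : i.*2 + d = (i + d./2).*2.+1 by lia.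
    by rewrite thue_morse_doubleS thue_morse_double addbN def_b negbK.
  by rewrite -doubleS thue_morse_doubleS thue_morse_double.
have [|i def_b eqi] := @thue_morse_return_ab d./2 b; first by case: b db => /=; lia.
exists i.*2.+1; have -> : i.*2.+1 + d = (i + d./2).*2.+1 by lia.
  by rewrite !thue_morse_doubleS addbN addNb def_b negbK.
by rewrite -doubleS thue_morse_doubleS thue_morse_double.
Qed.

(** For odd [d] the far pair straddles two blocks, which must come from equal letters. The excluded
    distance 3 is the pattern of [thue_morse_no_ab_ba]. *)
Lemma thue_morse_ab_return_ab d b :
    (if b then (d != 0) && (d != 3) else d != 1) ->
  exists i, [/\ t i.+1 = ~~ t i, t i (+) t (i + d) = b & t (i + d).+1 = ~~ t (i + d)].
Proof.
move=> db; have [od|ed] := boolP (odd d).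
  have [|i def_b eqi] := @thue_morse_return_aa d./2 (~~ b).
    by case: b db => /=; lia.
  exists i.*2; have -> : i.*2 + d = (i + d./2).*2.+1 by lia.
  by rewrite -doubleS !thue_morse_doubleS !thue_morse_double addbN def_b !negbK eqi.
have [|i <-] := @thue_morse_return d./2 b; first by case: b db => /=; lia.
exists i.*2; have -> : i.*2 + d = (i + d./2).*2 by lia.
by rewrite !thue_morse_doubleS !thue_morse_double.
Qed.

(** * Words across the seam of a conjugate *)

(* The length-[a] suffix of [t i .. t (i + n - 1)] followed by that same word:
   a factor of a conjugate that is not a factor of the word itself has this form. *)
Definition seam i n a k : bool := if k < a then t (i + n - a + k) else t (i + (k - a)).

Definition seam_periodic i n a l p : Prop :=
  forall k, k + p < l -> seam i n a k = seam i n a (k + p).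

Lemma has_periodP (w : seq bool) p :
  reflect (0 < p <= size w /\
           forall k, k + p < size w -> nth false w k = nth false w (k + p))
          (has_period w p).
Proof.
apply: (iffP andP) => -[p_bd per]; split=> //.
  move=> k ltk; have /(allP per)/eqP : k \in iota 0 (size w - p).
    by rewrite mem_iota; lia.
  by rewrite -!(odflt_onth false) => ->.
apply/allP => k; rewrite mem_iota => ltk; apply/eqP.
have {}ltk : k < size w - p by [].
have ltkp : k + p < size w by lia.
have ltk' : k < size w by lia.
by rewrite !onthE !(nth_map false) // per.
Qed.

Definition tm_factor i n := mkseq (fun j => t (i + j)) n.

Lemma cce_seam_ge i n a b p : a + b <= n -> 0 < p <= a + b ->
    seam_periodic i n a (a + b) p ->
  ((a + b)%:R / p%:R <= cce (tm_factor i n))%R.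
Proof.
move=> le_n p_bd per; set x := tm_factor i n.
have size_x : size x = n by rewrite size_mkseq.
set w := drop (n - a) x ++ take b x.
have size_w : size w = a + b by rewrite size_cat size_drop size_takel size_x; lia.
have nth_w k : k < a + b -> nth false w k = seam i n a k.
  move=> ltk; rewrite nth_cat nth_drop size_drop size_x /seam subKn; last by lia.
  case: ifP => ltka; first by rewrite nth_mkseq; [congr t; lia | lia].
  by rewrite nth_take ?nth_mkseq; lia.
have [|_ cce_ge] := @cceP _ x; first by rewrite -size_eq0 size_x; lia.
have w_neq0 : w != [::] by rewrite -size_eq0 size_w; lia.
apply: le_trans (cce_ge (word_exp w) _); last first.
  (* The conjugate starting with the last [a] letters has [w] as a prefix, since [b <= n - a]. *)
  exists (drop (n - a) x ++ take (n - a) x), w; split.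
    by exists (take (n - a) x), (drop (n - a) x); rewrite cat_take_drop.
  split=> //; apply/infixP; exists [::], (drop b (take (n - a) x)).
  rewrite -catA /=; congr (_ ++ _).
  by rewrite -[take b x](@take_takel _ _ (n - a)) ?cat_take_drop //; lia.
have [/has_periodP[m_bd _] min_w] := min_periodP w_neq0.
rewrite /word_exp size_w ler_wpM2l ?ler0n // lef_pV2 ?posrE ?ltr0n ?ler_nat; try lia.
apply: min_w; apply/has_periodP; rewrite size_w; split=> // k ltk.
by rewrite !nth_w; [apply: per | | ]; lia.
Qed.

Lemma seam_l i n a k : k < a -> seam i n a k = t (i + n - a + k).
Proof. by rewrite /seam => ->. Qed.

Lemma seam_r i n a k : a <= k -> seam i n a k = t (i + (k - a)).
Proof. by rewrite /seam ltnNge => ->. Qed.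

(** * Upper bounds for repetitions across the seam *)

Section SeamPeriod.

Variables i n a l p : nat.
Hypotheses (le_al : a <= l) (le_ln : l <= n) (p_gt0 : 0 < p).
Hypothesis per : seam_periodic i n a l p.

Lemma seam_l_size : a <= p.*2.
Proof.
apply: (@thue_morse_period_le (i + n - a)) => // k ltk.
by rewrite -addnA -!seam_l; [apply: per | |]; lia.
Qed.

Lemma seam_r_size : l - a <= p.*2.
Proof.
apply: (@thue_morse_period_le i) => // k ltk.
have := @per (k + a); rewrite !seam_r; try lia.
by rewrite -addnA [a + p]addnC addnA !addnK addnA; apply; lia.
Qed.

Lemma seam_mod k : k < l -> seam i n a k = seam i n a (k %% p).
Proof.
elim/ltn_ind: k => k IH ltk; have [ltkp|lepk] := ltnP k p; first by rewrite modn_small.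
have := @per (k - p); rewrite subnK // => <- //.
by rewrite -[k in RHS](subnK lepk) modnDr; apply: IH; lia.
Qed.

Lemma seam_eq_mod k k' : k < l -> k' < l -> k = k' %[mod p] ->
  seam i n a k = seam i n a k'.
Proof. by move=> ltk ltk' eqk; rewrite seam_mod // eqk -seam_mod. Qed.

Hypothesis odd_n : odd n.

(* Over one odd period a repeated letter occurs, hence three times over three
   periods.  Repeated letters of the Thue-Morse word sit at odd positions, so no
   two consecutive ones are on the same side of the seam; then the second one
   straddles it, and the outer two sit at distance [n - 2 * p]. *)
Lemma seam_odd_period : odd p -> l <= 3 * p.
Proof.
move=> odd_p; rewrite leqNgt; apply/negP => ltl.
have [||k ltk eq0] := @odd_return (seam i n a) 0 p => //; first by apply: per; lia.
have eq1 : seam i n a (k + p) = seam i n a (k + p).+1 by rewrite -addSn -!per //; lia.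
have eq2 : seam i n a (k + p + p) = seam i n a (k + p + p).+1.
  by rewrite -!addSn -!per //; lia.
have odd_l j : seam i n a j = seam i n a j.+1 -> j.+1 < a -> odd (i + n - a + j).
  by move=> + lta; rewrite !seam_l ?addnS; [apply: odd_equal_pair | lia | lia].
have odd_r j : seam i n a j = seam i n a j.+1 -> a <= j -> odd (i + (j - a)).
  by move=> + lta; rewrite !seam_r ?subSn ?addnS //; [apply: odd_equal_pair | lia].
have l0 := odd_l _ eq0; have l1 := odd_l _ eq1; have r1 := odd_r _ eq1.
have r2 := odd_r _ eq2; lia.
Qed.

(** Each side is longer than [p], and this forces the letters to alternate; a side then has at most
    4 letters, so [p = 2], and the positions of the two sides modulo 4 determine [n] modulo 4. *)
Lemma seam_even_period : ~~ odd p -> 3 * p < l ->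
  [/\ p = 2, l = 7, n %% 4 = 3 & n != 15].
Proof.
move=> even_p ltl; have lea := seam_l_size; have leb := seam_r_size.
have shift k k' : k.+1 < l -> k'.+1 < l -> k = k' %[mod p] ->
    [/\ odd k = odd k', seam i n a k = seam i n a k' &
        seam i n a k.+1 = seam i n a k'.+1].
  move=> ltk ltk' kk'; split.
  - have := congr1 odd (divn_eq k p); have := congr1 odd (divn_eq k' p).
    by rewrite kk' !oddD !oddM (negbTE even_p) !andbF => -> ->.
  - by apply: seam_eq_mod; rewrite ?(ltnW ltk) ?(ltnW ltk').
  - by apply: seam_eq_mod; rewrite // -addn1 -[k'.+1]addn1 -modnDml kk' modnDml.
(* Both sides of the seam are longer than [p], and since [n] is odd, the blocks
   [mu b] they consist of start at different parities of the index [k]. *)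
have alt k : k.+1 < l -> seam i n a k <> seam i n a k.+1.
  move=> ltk; have [o_l|e_l] := boolP (odd (i + n - a + k)); last first.
    have [k' ltk' kk'] : exists2 k', k' < p & k = k' %[mod p].
      by exists (k %% p); rewrite ?ltn_mod // modn_mod.
    have [||pk -> ->] := shift _ _ _ _ kk'; try lia.
    rewrite !seam_l ?addnS; try lia.
    by rewrite thue_morse_even; [case: (t _) | clear kk'; lia].
  have [k' lek' kk'] : exists2 k', a <= k' < a + p & k = k' %[mod p].
    (* Adding [a * p.-1] amounts to subtracting [a] modulo [p]. *)
    exists (a + (k + a * p.-1) %% p); first by rewrite leq_addr ltn_add2l ltn_mod.
    rewrite modnDmr addnCA -[X in k + X]/(a + a * p.-1) -mulnS prednK //.
    by rewrite addnC modnMDl.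
  have [||pk -> ->] := shift _ _ _ _ kk'; try lia.
  rewrite !seam_r ?subSn ?addnS; try lia.
  by rewrite thue_morse_even; [case: (t _) | clear kk'; lia].
have alt2 k : k.+2 < l -> seam i n a k = seam i n a k.+2.
  move=> ltk; have := alt k; have := alt k.+1.
  by case: (seam _ _ _ k) (seam _ _ _ k.+1) (seam _ _ _ k.+2) => [] [] [] nk nk1 //;
    [case: nk1 | case: nk | case: nk | case: nk1]; rewrite // ltnW.
have alt2_l k : k.+2 < a -> t (i + n - a + k) = t (i + n - a + k + 2).
  by move=> ltk; rewrite -addnA -!seam_l; [rewrite addn2; apply: alt2 | |]; lia.
have alt2_r k : k.+2 < l - a -> t (i + k) = t (i + k + 2).
  move=> ltk; have ltk' : (a + k).+2 < l by lia.
  have := alt2 _ ltk'; rewrite !seam_r; try lia.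
  by rewrite addKn (_ : i + ((a + k).+2 - a) = i + k + 2) //; lia.
have alt_l k : k.+1 < a -> t (i + n - a + k) <> t (i + n - a + k + 1).
  by move=> ltk; rewrite -addnA -!seam_l ?addn1; [apply: alt | |]; lia.
have alt_r k : k.+1 < l - a -> t (i + k) <> t (i + k + 1).
  move=> ltk; have ltk' : (a + k).+1 < l by lia.
  have := alt _ ltk'; rewrite !seam_r; try lia.
  by rewrite addKn (_ : i + ((a + k).+1 - a) = i + k + 1) //; lia.
have le4 j m : (forall k, k.+2 < m -> t (j + k) = t (j + k + 2)) -> m <= 4.
  move=> eqj; rewrite leqNgt; apply/negP => ltm; apply: (@thue_morse_no_alt5 j).
  by split; [have := eqj 0 | have := eqj 1 | have := eqj 2];
    rewrite -!addnA ?addn0; apply; lia.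
have even4 j : (forall k, k.+2 < 4 -> t (j + k) = t (j + k + 2)) ->
    t j <> t (j + 1) -> ~~ odd j.
  move=> eqj nej; apply: thue_morse_alt4_even nej _ _.
    by rewrite -[in LHS](addn0 j) eqj // addn0.
  by rewrite eqj // -addnA.
have la4 := le4 _ _ alt2_l; have lb4 := le4 _ _ alt2_r.
(* [3 * p < l <= 8] with [p] even and positive. *)
have p2 : p = 2 by lia.
have aba0 j m : (forall k, k.+2 < m -> t (j + k) = t (j + k + 2)) -> 2 < m ->
    t j = t (j + 2).
  by move=> eqj ltm; have := eqj 0 ltm; rewrite addn0.
have eq_l := aba0 _ _ alt2_l; have eq_r := aba0 _ _ alt2_r.
(* The possible splits are 4+3, 3+4 and 4+4; in the last, both sides would start at even positions,
   against [n] odd. *)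
have [[a4 b3]|[a3 b4]] : (a = 4 /\ l = 7) \/ (a = 3 /\ l = 7).
- case: (ltngtP a 4) => [lta|gta|a4]; first by right; lia.
    by lia.
  left; split=> //; have [//|nl7] := eqVneq l 7; have l8 : l = 8 by lia.
  have odd_l : ~~ odd (i + n - a).
    apply: even4 => [k ltk|]; first by apply: alt2_l; rewrite a4.
    by have := alt_l 0; rewrite addn0; apply; rewrite a4.
  have odd_r : ~~ odd i.
    apply: even4 => [k ltk|]; first by apply: alt2_r; rewrite a4 l8.
    by have := alt_r 0; rewrite addn0; apply; rewrite a4 l8.
  lia.
- have even_l : ~~ odd (i + n - a).
    apply: even4 => [k ltk|]; first by apply: alt2_l; rewrite a4.
    by have := alt_l 0; rewrite addn0; apply; rewrite a4.
  have mod_l : (i + n - a) %% 4 = 2.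
    by apply: thue_morse_aba_mod4 (eq_l _); rewrite ?a4 // -a4.
  have odd_i : odd i by lia.
  have def_i : i = i.-1.+1 by lia.
  have ne_i : t i <> t (i + 1).
    by have := alt_r 0; rewrite addn0; apply; rewrite a4 b3.
  (* The letter before the right side is the other half of its first block, so an [aba] starts at
     the even position [i.-1]. *)
  have eq_i : t i.-1 = t (i + 1).
    have := @thue_morse_even i.-1; rewrite -def_i => eqi; move: ne_i.
    by rewrite eqi; [case: (t _) (t _) => [] [] | lia].
  have mod_r : i.-1 %% 4 = 2.
    apply: thue_morse_aba_mod4; first by lia.
    by rewrite eq_i; congr t; lia.
  split=> //; first by lia.
  (* Undoing [mu] twice at distance 15 turns the alternation into the pattern [ab?ba] at [q]. *)
  apply/eqP => n15; have [q def_i4] : exists q, i = 4 * q + 3 by exists (i %/ 4); lia.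
  have def_l : i + n - a = 4 * (q + 3) + 2 by clear mod_r mod_l; lia.
  have seam0 : t (i + n - a) = t i.
    have <- : seam i n a 0 = t (i + n - a) by rewrite seam_l ?addn0 ?a4.
    have <- : seam i n a 4 = t i by rewrite seam_r a4 // subnn addn0.
    by rewrite (alt2 0) ?(alt2 2) ?b3.
  have := @thue_morse_no_ab_ba q.
  have t3 : t i = t q by rewrite def_i4 thue_morse_mul4D3.
  have t4 : t (i + 1) = t (q + 1).
    by rewrite -(thue_morse_mul4 (q + 1)) def_i4; congr t; clear; lia.
  have t14 : t (i + n - a) = ~~ t (q + 3) by rewrite def_l thue_morse_mul4D2.
  have t16 : t (i + n - a + 2) = t (q + 4).
    by rewrite def_l -(thue_morse_mul4 (q + 4)); congr t; clear; lia.
  rewrite -t4 -t16 -eq_l ?a4 // -a4 seam0 -t3; apply=> //; first exact: nesym.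
  by rewrite -seam0 t14; case: (t _).
have even_r : ~~ odd i.
  apply: even4 => [k ltk|]; first by apply: alt2_r; rewrite a3 b4.
  by have := alt_r 0; rewrite addn0; apply; rewrite a3 b4.
have mod_r : i %% 4 = 2 by apply: thue_morse_aba_mod4 (eq_r _); rewrite ?a3 ?b4.
have mod_l : (i + n - a) %% 4 = 2.
  by apply: thue_morse_aba_mod4 (eq_l _); rewrite ?a3 //; lia.
split=> //; first by lia.
(* The same contradiction at [q], now with [i] in residue class 2 modulo 4. *)
apply/eqP => n15; have [q def_i] : exists q, i = 4 * q + 2 by exists (i %/ 4); lia.
have def_l : i + n - a = 4 * (q + 3) + 2 by clear mod_r mod_l; lia.
have seam0 : t (i + n - a) <> t i.
  have <- : seam i n a 0 = t (i + n - a) by rewrite seam_l ?addn0 ?a3.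
  have <- : seam i n a 3 = t i by rewrite seam_r a3 // subnn addn0.
  by rewrite (alt2 0) ?b4 //; apply: alt; rewrite b4.
have := @thue_morse_no_ab_ba q.
have t2 : t i = ~~ t q by rewrite def_i thue_morse_mul4D2.
have t4 : t (i + 2) = t (q + 1).
  by rewrite -(thue_morse_mul4 (q + 1)) def_i; congr t; clear; lia.
have t14 : t (i + n - a) = ~~ t (q + 3) by rewrite def_l thue_morse_mul4D2.
have t16 : t (i + n - a + 2) = t (q + 4).
  by rewrite def_l -(thue_morse_mul4 (q + 4)); congr t; clear; lia.
have e_l : t (i + n - a) = t (i + n - a + 2) by apply: eq_l; rewrite a3.
have e_r : t i = t (i + 2) by apply: eq_r; rewrite a3 b4.
rewrite -t4 -t16 -e_l -e_r; move: seam0; rewrite t14 t2.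
by case: (t q) (t (q + 3)) => [] [] //= ne h; apply: h.
Qed.

End SeamPeriod.

(** * From circular critical exponents to seams *)

(* The conjugate [z ++ y] of [y ++ z] is a factor of [(y ++ z) ++ (y ++ z)]. *)
Lemma infix_conjugate (y z w : seq bool) (x := y ++ z) : infix w (z ++ y) ->
  size w <= size x /\ exists2 c, c + size w <= size x + size x &
    forall k, k < size w ->
      nth false w k = nth false x (if c + k < size x then c + k else c + k - size x).
Proof.
move=> w_in; split; first by have /size_infix := w_in; rewrite !size_cat addnC.
have [r [r' def_zy]] : exists r r', z ++ y = r ++ w ++ r'.
  by have /infixP[r [r' ->]] := w_in; exists r, r'.
have def_xx : x ++ x = (y ++ r) ++ w ++ r' ++ z.
  by rewrite /x -!catA; congr (y ++ _); rewrite !catA def_zy -!catA.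
exists (size (y ++ r)) => [|k ltk].
  by have := congr1 size def_xx; rewrite !size_cat /=; lia.
have /(congr1 (nth false ^~ (size (y ++ r) + k))) := def_xx.
rewrite !(nth_cat _ x) (nth_cat _ (y ++ r)) [_ + k < size (y ++ r)]ltnNge leq_addr.
rewrite /= addKn nth_cat ltk => <-.
by case: ifP.
Qed.

(** A factor of maximal exponent either lies within one copy of the word, where overlap-freeness
    bounds it, or crosses the seam. *)
Lemma cce_tm_factor i n : 0 < n -> exists l p,
  [/\ 0 < p <= l, l <= n, cce (tm_factor i n) = (l%:R / p%:R)%R &
      l <= p.*2 \/ exists2 a, a <= l & seam_periodic i n a l p].
Proof.
move=> n_gt0; set x := tm_factor i n; have size_x : size x = n by rewrite size_mkseq.
have [|[v [w [[y [z [def_x ->]]] [w_neq0 w_in ->]]]] _] := @cceP _ x.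
  by rewrite -size_eq0 size_x -lt0n.
have [/has_periodP] := min_periodP w_neq0; rewrite /word_exp.
have /= := infix_conjugate w_in; rewrite -def_x size_x.
move: (size w) (min_period w) => l p [le_ln [c le_c nth_w]] [/= p_bd per] _.
have {}nth_w k : k < l ->
    nth false w k = t (i + if c + k < n then c + k else c + k - n).
  by move=> ltk; rewrite nth_w // nth_mkseq //; case: ifP; lia.
exists l, p; split=> //.
have [lt_n|le_n] := ltnP n (c + l); last first.
  left; apply: (@thue_morse_period_le (i + c)); first by case/andP: p_bd.
  move=> k ltk; have := per k ltk; rewrite !nth_w; try lia.
  rewrite !ifT; try lia.
  by rewrite !addnA.
have [lt_c|le_c'] := ltnP c n; last first.
  left; apply: (@thue_morse_period_le (i + (c - n))); first by case/andP: p_bd.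
  move=> k ltk; have := per k ltk; rewrite !nth_w; try lia.
  rewrite !ifF; try lia.
  by rewrite -!addnA -!addnBAC.
right; exists (n - c); first by lia.
have nth_seam k : k < l -> nth false w k = seam i n (n - c) k.
  move=> ltk; rewrite nth_w // /seam ltn_subRL.
  by case: ifP => ltck; congr t; lia.
by move=> k ltk; rewrite -!nth_seam; [apply: per | |]; lia.
Qed.

(** Period 1 on a whole conjugate makes the factor itself constant, hence a cube once [n > 2]. This
    settles lengths 3 and 4. *)
Lemma seam_full_period1 i n a : a <= n -> seam_periodic i n a n 1 -> n <= 2.
Proof.
move=> lean per; rewrite leqNgt; apply/negP => ltn.
have eq_seam j : j < n -> t (i + j) = seam i n a 0.
  move=> ltj; have eq0 k : k < n -> seam i n a k = seam i n a 0.
    by move=> ltk; apply: (seam_eq_mod lean (leqnn n) (ltn0Sn 0) per);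
      rewrite ?modn1 //; lia.
  have [ltja|leja] := ltnP j (n - a).
    by rewrite -(eq0 (a + j)) ?seam_r ?addKn //; lia.
  by rewrite -(eq0 (j - (n - a))) ?seam_l; [congr t | |]; lia.
apply: (@thue_morse_no_cube i); rewrite -(addn2 i) -(addn1 i) -{1}(addn0 i).
by rewrite !eq_seam //; lia.
Qed.

(** Reduces a value [c / d] to a cross-multiplied bound on natural numbers and one seam word of
    length [c] and period [d]. *)
Lemma greatest_cce n c d : 0 < d <= c -> c <= n ->
    (forall i l p, 0 < p -> l <= n ->
      l <= p.*2 \/ (exists2 a, a <= l & seam_periodic i n a l p) ->
      d * l <= c * p) ->
    (exists i a, a <= c /\ seam_periodic i n a c d) ->
  greatest (fun e => exists x : seq bool, factor_of t x /\ size x = n /\ e = cce x)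
    (c%:R / d%:R)%R.
Proof.
move=> /andP[d_gt0 le_dc] le_cn upper [i [a [le_ac per]]].
have le_cd j : (cce (tm_factor j n) <= c%:R / d%:R)%R.
  have [|l [p [/andP[p_gt0 le_pl] le_ln -> lp]]] := @cce_tm_factor j n; first by lia.
  rewrite ler_pdivrMr ?ltr0n // mulrAC ler_pdivlMr ?ltr0n //.
  by rewrite -!natrM ler_nat mulnC; apply: upper lp.
split=> [|e [x [[j def_x] [size_x ->]]]]; last by rewrite def_x size_x le_cd.
exists (tm_factor i n); split; first by exists i; rewrite size_mkseq.
split; first by rewrite size_mkseq.
apply/le_anti; rewrite le_cd andbT.
have := @cce_seam_ge i n a (c - a) d; rewrite subnKC //.
by apply; rewrite ?d_gt0.
Qed.

(** * Repetitions attaining the bounds *)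

(** Equal pairs [ab] at distance [m] become, under [mu], two copies of [bb] straddling block
    boundaries, and the seam joins them. *)
Lemma seam_power4 m : m != 1 -> exists i, seam_periodic i (2 * m + 2) 2 4 1.
Proof.
move=> m1; have [|j [ab ret ba]] := @thue_morse_ab_return_ab m false; first by [].
have {}ret : t (j + m) = t j by case: (t j) (t (j + m)) ret => [] [].
exists j.*2.+1; suff eq_seam k : k < 4 -> seam j.*2.+1 (2 * m + 2) 2 k = ~~ t j.
  by move=> k ltk; rewrite !eq_seam //; lia.
case: k => [|[|[|[|k]]]] // _; rewrite /seam /=.
- rewrite (_ : _ + 0 = (j + m).*2.+1); last by lia.
  by rewrite thue_morse_doubleS ret.
- rewrite (_ : _ + 1 = (j + m).+1.*2); last by lia.
  by rewrite thue_morse_double ba ret.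
- by rewrite addn0 thue_morse_doubleS.
- by rewrite addn1 -doubleS thue_morse_double.
Qed.

(** The image of [a] under [mu] twice is [abba]; the seam puts the first [b] of one such block
    before the [bb] of another. *)
Lemma seam_power3 m : exists i, seam_periodic i (4 * m + 1) 1 3 1.
Proof.
have [|j ret] := @thue_morse_return m false; first by rewrite orbT.
have {}ret : t (j + m) = t j by case: (t j) (t (j + m)) ret => [] [].
exists (4 * j + 1).
suff eq_seam k : k < 3 -> seam (4 * j + 1) (4 * m + 1) 1 k = ~~ t j.
  by move=> k ltk; rewrite !eq_seam //; lia.
case: k => [|[|[|k]]] // _; rewrite /seam /=.
- rewrite (_ : _ + 0 = 4 * (j + m) + 1); last by lia.
  by rewrite thue_morse_mul4D1 ret.
- by rewrite addn0 thue_morse_mul4D1.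
- by rewrite -addnA thue_morse_mul4D2.
Qed.

(** Pairs [ab] and [ba] at distance [m] are substituted twice; the ends of their first blocks run on
    alternately into the next ones, with 3 letters before the seam and 4 after it. *)
Lemma seam_power72 m : m != 0 -> m != 3 -> exists i, seam_periodic i (4 * m + 3) 3 7 2.
Proof.
move=> m0 m3; have [|j [ab ret ba]] := @thue_morse_ab_return_ab m true.
  by rewrite m0.
have {}ret : t (j + m) = ~~ t j by case: (t j) (t (j + m)) ret => [] [].
exists (4 * j + 2).
suff eq_seam k : k < 7 -> seam (4 * j + 2) (4 * m + 3) 3 k = odd k (+) t j.
  by move=> k ltk; rewrite !eq_seam ?oddD ?addbF //; lia.
case: k => [|[|[|[|[|[|[|k]]]]]]] // _; rewrite /seam /=.
- rewrite (_ : _ + 0 = 4 * (j + m) + 2); last by lia.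
  by rewrite thue_morse_mul4D2 ret negbK.
- rewrite (_ : _ + 1 = 4 * (j + m) + 3); last by lia.
  by rewrite thue_morse_mul4D3 ret.
- rewrite (_ : _ + 2 = 4 * (j + m).+1); last by lia.
  by rewrite thue_morse_mul4 ba ret negbK.
- by rewrite addn0 thue_morse_mul4D2.
- by rewrite -addnA thue_morse_mul4D3.
- rewrite (_ : _ + _ = 4 * j.+1); last by lia.
  by rewrite thue_morse_mul4 ab.
- rewrite (_ : _ + _ = 4 * j.+1 + 1); last by lia.
  by rewrite thue_morse_mul4D1 ab negbK.
Qed.

(** * The automaton *)

(** The state reached on [n]. Length 7 is kept apart from state 8, which has the same output,
    because appending the digit 1 gives the exceptional 15. *)
Definition state_of n :=
  if n <= 4 then n else if n == 7 then 5 else if ~~ odd n then 6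
  else if (n %% 4 == 1) || (n == 15) then 7 else 8.

(* Entry [2 * q + d] is the successor of state [q] on digit [d]. *)
Definition next_state : seq nat :=
  [:: 0; 1; 2; 3; 4; 7; 6; 5; 6; 7; 6; 7; 6; 7; 6; 8; 6; 8].

Definition state_output : seq rat := [:: 0; 1; 2; 2; 3; 7 / 2; 4; 3; 7 / 2]%R.

Lemma next_state_of m d : d < 2 ->
  nth 0 next_state (2 * state_of m + d) = state_of (2 * m + d).
Proof.
move=> ltd; have [ltm|lem] := ltnP m 8.
  by case: d ltd => [|[|d]] // _; move: m ltm; do 8![case=> //].
rewrite /state_of; case: (boolP (odd m)) => om.
  have -> : (m <= 4) = false by lia.
  have -> : (m == 7) = false by lia.
  have -> : (2 * m + d <= 4) = false by lia.
  have -> : (2 * m + d == 7) = false by lia.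
  have -> : (2 * m + d == 15) = false by lia.
  have -> : odd (2 * m + d) = (d == 1) by lia.
  have -> : ((2 * m + d) %% 4 == 1) = false by lia.
  by case: ifP; case: d ltd => [|[|d]].
have -> : (m <= 4) = false by lia.
have -> : (m == 7) = false by lia.
have -> : (2 * m + d <= 4) = false by lia.
have -> : (2 * m + d == 7) = false by lia.
have -> : odd (2 * m + d) = (d == 1) by lia.
by case: d ltd => [|[|d]] // _; rewrite (_ : ((2 * m + 1) %% 4 == 1) = true) //; lia.
Qed.

Lemma state_outputP n : 0 < n ->
  greatest (fun e => exists x : seq bool, factor_of t x /\ size x = n /\ e = cce x)
    (nth 0%R state_output (state_of n)).
Proof.
move=> n_gt0; rewrite /state_of.
have le4p i l p : 0 < p -> l <= n ->
    l <= p.*2 \/ (exists2 a, a <= l & seam_periodic i n a l p) -> 1 * l <= 4 * p.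
  move=> p_gt0 le_ln [|[a le_al per]]; first by lia.
  have := seam_l_size le_al le_ln p_gt0 per.
  have := seam_r_size le_al le_ln p_gt0 per; lia.
case: ifP => [le_n4|gt_n4].
  case: n n_gt0 le_n4 {le4p} => [|[|[|[|[|n]]]]] // _ _ /=.
  - rewrite -[1%R]divr1; apply: (@greatest_cce 1 1 1) => //; first by move=> i l p; lia.
    by exists 0, 0; split=> // k; lia.
  - rewrite -[2%R]divr1; apply: (@greatest_cce 2 2 1) => //; first by move=> i l p; lia.
    by exists 1, 0; split=> // -[|k]; [|lia].
  - rewrite -[2%R]divr1; apply: (@greatest_cce 3 2 1) => //.
      move=> i l p p_gt0 le_l [|[a le_al per]]; first by lia.
      rewrite leqNgt; apply/negP => ltl.
      have l3 : l = 3 by lia.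
      have p1 : p = 1 by lia.
      by subst l p; have := seam_full_period1 le_al per.
    by exists 1, 0; split=> // -[|k]; [|lia].
  - rewrite -[3%R]divr1; apply: (@greatest_cce 4 3 1) => //.
      move=> i l p p_gt0 le_l [|[a le_al per]]; first by lia.
      rewrite leqNgt; apply/negP => ltl.
      have l4 : l = 4 by lia.
      have p1 : p = 1 by lia.
      by subst l p; have := seam_full_period1 le_al per.
    (* Across the seam, [t 4] is followed by [t 1] and [t 2], all three being 1. *)
    by exists 1, 1; split=> // -[|[|k]]; [| |lia].
have le3p i l p : odd n -> ~~ ((n %% 4 == 3) && (n != 15)) -> 0 < p -> l <= n ->
    l <= p.*2 \/ (exists2 a, a <= l & seam_periodic i n a l p) -> 1 * l <= 3 * p.
  move=> odd_n n_mod p_gt0 le_ln [|[a le_al per]]; first by lia.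
  have [odd_p|even_p] := boolP (odd p).
    by have := seam_odd_period le_al le_ln p_gt0 per odd_n odd_p; lia.
  rewrite leqNgt mul1n; apply: contra n_mod => ltl.
  by have [_ _ -> ->] := seam_even_period le_al le_ln p_gt0 per odd_n even_p ltl.
have le7p i l p : odd n -> 0 < p -> l <= n ->
    l <= p.*2 \/ (exists2 a, a <= l & seam_periodic i n a l p) -> 2 * l <= 7 * p.
  move=> odd_n p_gt0 le_ln [|[a le_al per]]; first by lia.
  have [odd_p|even_p] := boolP (odd p).
    by have := seam_odd_period le_al le_ln p_gt0 per odd_n odd_p; lia.
  have [|ltl] := leqP l (3 * p); first by lia.
  by have [-> -> _ _] := seam_even_period le_al le_ln p_gt0 per odd_n even_p ltl.
have exists7 : n %% 4 = 3 -> n != 3 -> n != 15 ->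
    exists i a, a <= 7 /\ seam_periodic i n a 7 2.
  move=> n_mod n3 n15; have [m def_n] : exists m, n = 4 * m + 3 by exists (n %/ 4); lia.
  rewrite def_n; have [||i per] := @seam_power72 m; [lia | lia |].
  by exists i, 3.
case: eqP => [n7 /=|n7].
  apply: (@greatest_cce n 7 2) => //; [by rewrite n7 | | by apply: exists7; lia].
  by move=> i l p; apply: le7p; lia.
have [odd_n|even_n] := boolP (odd n); rewrite /=; last first.
  rewrite -[4%R]divr1; apply: (@greatest_cce n 4 1) => //; first by lia.
  have [m def_n] : exists m, n = 2 * m + 2 by exists (n./2).-1; lia.
  rewrite def_n; have [|i per] := @seam_power4 m; first by lia.
  by exists i, 2.
case: ifP => [n_mod|n_mod] /=; last first.
  apply: (@greatest_cce n 7 2) => //; [by lia | by move=> i l p; apply: le7p |].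
  by apply: exists7; lia.
rewrite -[3%R]divr1; apply: (@greatest_cce n 3 1) => //; first by lia.
  by move=> i l p; apply: le3p => //; lia.
have [->|n15] := eqVneq n 15.
  (* Length 15 is not of the form [4 * m + 1]; here the cube consists of [t 21], [t 7] and [t 8],
     all equal to 1. *)
  by exists 7, 1; split=> // -[|[|k]]; [| |lia].
have [m def_n] : exists m, n = 4 * m + 1 by exists (n %/ 4); lia.
by rewrite def_n; have [i per] := seam_power3 m; exists i, 1.
Qed.

Definition step_state (q : 'I_9) (d : 'I_2) : 'I_9 :=
  inord (nth 0 next_state (2 * q + d)).

Lemma state_output_in (q : 'I_9) : nth 0%R state_output q \in state_output.
Proof. by rewrite mem_nth. Qed.

Lemma state_of_lt n : state_of n < 9.
Proof. by rewrite /state_of; do 4?[case: ifP => //]; lia. Qed.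

Lemma foldl_step_state (s : seq 'I_2) m :
  foldl step_state (inord (state_of m)) s =
  inord (state_of (foldl (fun m (d : 'I_2) => 2 * m + d) m s)).
Proof.
elim: s m => //= d s IH m.
by rewrite -IH -next_state_of // /step_state inordK ?state_of_lt.
Qed.

Theorem theorem15 :
  exists M : dfao 2 rat,
    #|M| = 9 /\
    forall n : nat, 0 < n ->
      greatest
        (fun e => exists x : seq bool,
           factor_of thue_morse x /\ size x = n /\ e = cce x)
        (dfao_run M (base2 n)).
Proof.
exists (Dfao step_state ord0 state_output_in); split; first exact: card_ord.
move=> n n_gt0; rewrite /dfao_run /=.
have -> : ord0 = inord (state_of 0) :> 'I_9 by apply: val_inj; rewrite /= inordK.
rewrite foldl_step_state (base2P n_gt0).2 inordK ?state_of_lt //.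
exact: state_outputP.
Qed.
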